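(* Let $V=\{1,\dots,m\}$ be a finite node set and $E$ a set of unordered pairs $(s,t)$ of distinct nodes (the edges), and put $d=|V|+|E|+1$. For $\theta=\big((\tau_s)_{s\in V},(\sigma_{st})_{(s,t)\in E},\alpha^2\big)\in\mathbb{R}^d$, let $p_\theta$ be the Blume-Capel distribution on $\{-1,0,+1\}^V$ (with the inverse temperature absorbed into the parameters), $$p_\theta(x)=\frac{1}{Z_\theta}\exp\Big(\sum_{s\in V}\tau_s x_s+\sum_{(s,t)\in E}\sigma_{st}x_sx_t-\alpha^2\sum_{s\in V}x_s^2\Big),$$ $$Z_\theta=\sum_{x\in\{-1,0,+1\}^V}\exp\Big(\sum_{s\in V}\tau_s x_s+\sum_{(s,t)\in E}\sigma_{st}x_sx_t-\alpha^2\sum_{s\in V}x_s^2\Big).$$ Then $\{p_\theta:\theta\in\mathbb{R}^d\}$ is a full and minimal exponential family with sufficient statistic $$\phi(x)=\Big((x_s)_{s\in V},\,(x_sx_t)_{(s,t)\in E},\,\sum_{s\in V}x_s^2\Big).$$ Consequently, the model is identifiable: the map $\theta\mapsto p_\theta$ is injective on $\mathbb{R}^d$.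
   Context: The last component of $\theta$, written $\alpha^2$, is treated as a single real parameter; its natural (canonical) parameter is $-\alpha^2$. An exponential family $p_\theta(x)=\exp(\eta(\theta)^\top\phi(x)-\log Z_\theta)$ on a finite set is called full if the normalising constant $Z_\theta$ is finite for every parameter value, so that the natural parameter space is all of $\mathbb{R}^d$. It is called minimal if the sufficient statistics are non-redundant: there is no non-zero $a\in\mathbb{R}^d$ such that $a^\top\phi(x)$ is constant in $x\in\{-1,0,+1\}^V$. *)

(* Defs.v *)
From HB Require Import structures.
From mathcomp Require Import all_boot all_order all_algebra.
From mathcomp Require Import all_classical all_reals all_analysis.

Set Implicit Arguments.
Unset Strict Implicit.
Unset Printing Implicit Defensive.
Import Order.TTheory GRing.Theory Num.Theory.

Local Open Scope classical_set_scope.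
Local Open Scope ring_scope.

Definition dotv {R : realType} {d : nat} (a b : 'cV[R]_d) : R :=
  (a^T *m b) 0 0.

Section ExponentialFamily.
Context {R : realType} {X : finType} {d : nat}.
Implicit Types (eta : 'cV[R]_d -> 'cV[R]_d) (phi : X -> 'cV[R]_d).

(* The normalising constant at the natural parameter [h]. It is computed in the
   extended reals, so that its finiteness is a statement and not a typing
   artefact. *)
Definition norm_const phi (h : 'cV[R]_d) : \bar R :=
  (\sum_(x : X) (expR (dotv h (phi x)))%:E)%E.

Definition exponential_family (p : 'cV[R]_d -> X -> R) eta phi : Prop :=
  forall theta x,
    p theta x = expR (dotv (eta theta) (phi x)
                      - ln (fine (norm_const phi (eta theta)))).

Definition natural_parameter_space phi : set 'cV[R]_d :=
  [set h | (norm_const phi h < +oo)%E].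

Definition full_family eta phi : Prop :=
  [/\ forall theta, (norm_const phi (eta theta) < +oo)%E,
      natural_parameter_space phi = setT
    & range eta = natural_parameter_space phi].

Definition minimal_statistic phi : Prop :=
  ~ exists a : 'cV[R]_d,
      a != 0 /\ exists c : R, forall x, dotv a (phi x) = c.

End ExponentialFamily.

Section BlumeCapel.
Context {R : realType} {m : nat}.

Definition spin : finType := seq_sub [:: -1; 0; 1 : int].

Definition config : finType := {ffun 'I_m -> spin}.

Definition spin_val (x : config) (s : 'I_m) : R := (ssval (x s))%:~R.

(* An edge is the two-element set of its endpoints, so for [e = {s, t}] this is
   [x_s * x_t]. *)
Definition edge_val (x : config) (e : {set 'I_m}) : R :=
  \prod_(s in e) spin_val x s.

Variable E : {set {set 'I_m}}.

(* Coordinates are ordered as nodes, then edges, then the quadratic term; the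
   [i]-th edge coordinate belongs to the edge [enum_val i] of [E]. *)
Implicit Types (theta : 'cV[R]_(m + #|E| + 1)) (x : config).

Definition tau theta (s : 'I_m) : R := usubmx (usubmx theta) s 0.
Definition sigma theta (i : 'I_#|E|) : R := dsubmx (usubmx theta) i 0.
(* The single real parameter written alpha^2; it may be negative. *)
Definition alpha2 theta : R := dsubmx theta 0 0.

Definition bc_exponent theta x : R :=
  \sum_(s < m) tau theta s * spin_val x s
  + \sum_(i < #|E|) sigma theta i * edge_val x (enum_val i)
  - alpha2 theta * \sum_(s < m) spin_val x s ^+ 2.

Definition bc_Z theta : R := \sum_(x : config) expR (bc_exponent theta x).

Definition blume_capel theta x : R := (bc_Z theta)^-1 * expR (bc_exponent theta x).

Definition bc_natural theta : 'cV[R]_(m + #|E| + 1) :=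
  col_mx (usubmx theta) (- dsubmx theta).

Definition bc_stat x : 'cV[R]_(m + #|E| + 1) :=
  col_mx
    (col_mx (\col_(s < m) spin_val x s)
            (\col_(i < #|E|) edge_val x (enum_val i)))
    (\col_(_ < 1) \sum_(s < m) spin_val x s ^+ 2).

End BlumeCapel.

(* Main.v *)
Require Import Defs.
From mathcomp Require Import all_boot all_order all_algebra.
From mathcomp Require Import all_classical all_reals all_analysis.
From mathcomp Require Import lra.

(** Minimality is tested on constant configurations supported on small sets. If
    [a^T phi(x) = c] for all [x], the zero configuration gives [c = 0]. The
    configurations equal to 1 or -1 at one node [s] and 0 elsewhere kill every
    edge term, so [b + tau_s = b - tau_s = 0] for the quadratic coefficient [b];
    as there is a node, [b = 0] and all [tau_s = 0]. The configuration equal to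
    1 exactly on an edge [e] then leaves only the coefficient of [e].
    Identifiability follows from minimality: if [p_theta = p_theta'], then taking
    logarithms shows that [(eta(theta) - eta(theta'))^T phi] is constant. *)

Set Implicit Arguments.
Unset Strict Implicit.
Unset Printing Implicit Defensive.
Import Order.TTheory GRing.Theory Num.Theory.

Local Open Scope ring_scope.

Lemma dotv_col_mx (R : realType) (m n : nat) (a b : 'cV[R]_m) (c d : 'cV[R]_n) :
  dotv (col_mx a c) (col_mx b d) = dotv a b + dotv c d.
Proof. by rewrite /dotv tr_col_mx mul_row_col mxE. Qed.

Lemma dotvE (R : realType) (d : nat) (a b : 'cV[R]_d) :
  dotv a b = \sum_i a i 0 * b i 0.
Proof. by rewrite /dotv mxE; apply: eq_bigr => i _; rewrite mxE. Qed.

Lemma dotvBl (R : realType) (d : nat) (a b v : 'cV[R]_d) :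
  dotv (a - b) v = dotv a v - dotv b v.
Proof. by rewrite /dotv linearB mulmxBl !mxE. Qed.

Section ExponentialFamilyTheory.
Context {R : realType} {X : finType} {d : nat}.
Implicit Types (eta : 'cV[R]_d -> 'cV[R]_d) (phi : X -> 'cV[R]_d).

Lemma norm_constE phi h :
  norm_const phi h = (\sum_x expR (dotv h (phi x)))%:E.
Proof. by rewrite /norm_const sumEFin. Qed.

(** As [X] is finite, the normaliser is a finite sum of real exponentials, so no natural parameter
    is excluded. *)
Lemma natural_parameter_spaceT phi : natural_parameter_space phi = setT.
Proof.
apply/seteqP; split=> // h _.
by rewrite /natural_parameter_space /= norm_constE ltry.
Qed.

Lemma minimal_exponential_family_inj (p : 'cV[R]_d -> X -> R) eta phi :
  exponential_family p eta phi -> minimal_statistic phi -> injective eta ->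
  injective p.
Proof.
move=> pE phi_min eta_inj th1 th2 eq_p; apply: eta_inj; apply/eqP.
apply/negPn/negP => neq; apply: phi_min; exists (eta th1 - eta th2).
rewrite subr_eq0; split=> //.
(* Equal densities have equal exponents, so the two linear forms differ by the difference of the
   log-normalisers, which is free of [x]. *)
exists (ln (fine (norm_const phi (eta th1)))
        - ln (fine (norm_const phi (eta th2)))) => x.
have := congr1 (@^~ x) eq_p; rewrite /= !pE => /expR_inj.
by rewrite dotvBl => eqx; lra.
Qed.

End ExponentialFamilyTheory.

Definition spin0 : spin := SeqSub (isT : 0 \in [:: -1; 0; 1 : int]).

Section BlumeCapelTheory.
Context {R : realType} {m : nat}.
Variable E : {set {set 'I_m}}.

Lemma dotv_bc_stat (a : 'cV[R]_(m + #|E| + 1)) (x : config) :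
  dotv a (bc_stat E x) =
    \sum_(s < m) tau a s * spin_val x s
    + \sum_(i < #|E|) sigma a i * edge_val x (enum_val i)
    + alpha2 a * \sum_(s < m) spin_val x s ^+ 2.
Proof.
rewrite -{1}[a]vsubmxK -{1}[usubmx a]vsubmxK !dotv_col_mx !dotvE big_ord1 !mxE.
congr (_ + _ + _); last by rewrite /alpha2 mxE.
- by apply: eq_bigr => s _; rewrite /tau !mxE.
- by apply: eq_bigr => i _; rewrite /sigma !mxE.
Qed.

(** Serves twice: an involution is onto, which gives fullness, and one-to-one, which gives
    identifiability. *)
Lemma bc_naturalK : involutive (@bc_natural R m E).
Proof. by move=> a; rewrite /bc_natural col_mxKu col_mxKd opprK vsubmxK. Qed.

Lemma dotv_bc_natural (a : 'cV[R]_(m + #|E| + 1)) (x : config) :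
  dotv (bc_natural a) (bc_stat E x) = bc_exponent a x.
Proof.
rewrite dotv_bc_stat /bc_exponent /tau /sigma /alpha2 /bc_natural.
by rewrite col_mxKu col_mxKd mxE mulNr.
Qed.

Definition config_on (A : {set 'I_m}) (k : spin) : config :=
  [ffun s => if s \in A then k else spin0].

Lemma spin_val_config_on A k s :
  spin_val (config_on A k) s = (s \in A)%:R * (ssval k)%:~R :> R.
Proof. by rewrite /spin_val ffunE; case: ifP; rewrite ?mul1r ?mul0r. Qed.

(** An endpoint of [e] outside [A] contributes a factor 0 to the product. *)
Lemma edge_val_config_on_eq0 (A : {set 'I_m}) k (e : {set 'I_m}) :
  ~~ (e \subset A) -> edge_val (config_on A k) e = 0 :> R.
Proof.
case/subsetPn=> s se sA.
by rewrite /edge_val (bigD1 s) //= spin_val_config_on (negPf sA) !mul0r.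
Qed.

Lemma bc_Z_gt0 (a : 'cV[R]_(m + #|E| + 1)) : 0 < bc_Z a.
Proof.
rewrite /bc_Z (bigD1 (config_on finset.set0 spin0)) //=.
by rewrite ltr_pwDl ?expR_gt0 // sumr_ge0 // => x _; rewrite expR_ge0.
Qed.

Lemma bc_exponential_family :
  exponential_family (@blume_capel R m E) (@bc_natural R m E) (@bc_stat R m E).
Proof.
move=> a x; rewrite norm_constE /=.
under eq_bigr do rewrite dotv_bc_natural.
(* Positivity of [bc_Z] is what lets [expR] undo [ln] here. *)
by rewrite dotv_bc_natural expRD expRN lnK ?posrE ?bc_Z_gt0 // mulrC.
Qed.

Lemma bc_full_family : full_family (@bc_natural R m E) (@bc_stat R m E).
Proof.
split; first by move=> a; rewrite norm_constE ltry.
- exact: natural_parameter_spaceT.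
- rewrite natural_parameter_spaceT; apply/seteqP; split=> // a _.
  by exists (bc_natural a); rewrite ?bc_naturalK.
Qed.

Hypothesis m_gt0 : (0 < m)%N.
Hypothesis E_pairs : forall e, e \in E -> #|e| = 2%N.

(** An edge has two endpoints, so it never fits inside [A]. *)
Lemma edge_sum_config_on_small (a : 'cV[R]_(m + #|E| + 1)) (A : {set 'I_m}) k : (#|A| < 2)%N ->
  \sum_(i < #|E|) sigma a i * edge_val (config_on A k) (enum_val i) = 0.
Proof.
move=> A2; rewrite big1 // => i _; rewrite edge_val_config_on_eq0 ?mulr0 //.
apply/negP => /subset_leq_card; rewrite E_pairs ?enum_valP //.
by rewrite leqNgt A2.
Qed.

Lemma dotv_bc_stat_single (a : 'cV[R]_(m + #|E| + 1)) s k :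
  dotv a (bc_stat E (config_on [set s]%SET k)) =
    tau a s * (ssval k)%:~R + alpha2 a * (ssval k)%:~R ^+ 2.
Proof.
rewrite dotv_bc_stat edge_sum_config_on_small ?cards1 // addr0.
rewrite (bigD1 s) //= big1 => [|t ts]; last first.
  by rewrite spin_val_config_on finset.in_set1 (negPf ts) mul0r mulr0.
rewrite (bigD1 s) //= big1 => [|t ts]; last first.
  by rewrite spin_val_config_on finset.in_set1 (negPf ts) mul0r expr0n.
by rewrite spin_val_config_on set11 mul1r !addr0.
Qed.

Lemma bc_minimal_statistic : minimal_statistic (@bc_stat R m E).
Proof.
case=> a [a_neq0 [c ac]].
pose kN : spin := SeqSub (isT : -1 \in [:: -1; 0; 1 : int]).
pose k1 : spin := SeqSub (isT : 1 \in [:: -1; 0; 1 : int]).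
have c0 : c = 0.
  (* With value [spin0] this is the zero configuration, written so that the single-node formula
     applies. *)
  rewrite -(ac (config_on [set Ordinal m_gt0]%SET spin0)) dotv_bc_stat_single.
  by rewrite expr0n !mulr0 addr0.
have sum0 s : tau a s + alpha2 a = 0.
  rewrite -c0 -(ac (config_on [set s]%SET k1)) dotv_bc_stat_single.
  by rewrite expr1n !mulr1.
have diff0 s : - tau a s + alpha2 a = 0.
  rewrite -c0 -(ac (config_on [set s]%SET kN)) dotv_bc_stat_single /=.
  by rewrite mulrN1z sqrrN expr1n mulrN !mulr1.
(* A node is essential: for [m = 0] the quadratic statistic is constantly 0 and minimality fails. *)
have b0 : alpha2 a = 0.
  by have := sum0 (Ordinal m_gt0); have := diff0 (Ordinal m_gt0); lra.
have tau0 s : tau a s = 0 by rewrite -(sum0 s) b0 addr0.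
have sigma0 i : sigma a i = 0.
  have := ac (config_on (enum_val i) k1).
  rewrite c0 dotv_bc_stat b0 mul0r addr0 big1 => [|s _]; last first.
    by rewrite tau0 mul0r.
  rewrite add0r (bigD1 i) //= big1 => [|j ji]; last first.
    (* An edge contained in [enum_val i] equals it, both having two elements; every other edge thus
       meets a zero spin. *)
    rewrite edge_val_config_on_eq0 ?mulr0 //; apply: contra ji => sub.
    apply/eqP/enum_val_inj/eqP.
    by rewrite eqEcard sub !E_pairs ?enum_valP.
  rewrite addr0 /edge_val big1 ?mulr1 // => s se.
  by rewrite spin_val_config_on se mulr1.
move/negP: a_neq0; apply; apply/eqP.
rewrite -[a]vsubmxK -[usubmx a]vsubmxK.
have -> : usubmx (usubmx a) = 0.
  by apply/matrixP=> i j; rewrite (ord1 j) [RHS]mxE; exact: tau0.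
have -> : dsubmx (usubmx a) = 0.
  by apply/matrixP=> i j; rewrite (ord1 j) [RHS]mxE; exact: sigma0.
have -> : dsubmx a = 0.
  by apply/matrixP=> i j; rewrite (ord1 i) (ord1 j) [RHS]mxE; exact: b0.
by rewrite !col_mx0.
Qed.

End BlumeCapelTheory.

Theorem mainTheorem1 (R : realType) (m : nat) (E : {set {set 'I_m}})
    (m_gt0 : (0 < m)%N) (E_pairs : forall e, e \in E -> #|e| = 2%N) :
  [/\ exponential_family (@blume_capel R m E) (@bc_natural R m E)
        (@bc_stat R m E),
      full_family (@bc_natural R m E) (@bc_stat R m E),
      minimal_statistic (@bc_stat R m E)
    & injective (@blume_capel R m E)].
Proof.
have phi_min := @bc_minimal_statistic R m E m_gt0 E_pairs.
split=> //.
- exact: bc_exponential_family.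
- exact: bc_full_family.
- apply: minimal_exponential_family_inj phi_min _.
  + exact: bc_exponential_family.
  + exact: inv_inj (@bc_naturalK R m E).
Qed.
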